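(* Let $\widetilde M=(\mathbb{R}^2,dt^2+f(t)^2d\theta^2)$ be a non-compact model surface of revolution admitting a finite total curvature $c(\widetilde M)<2\pi$, and let $K(t):=-f''(t)/f(t)$. Then for every $\varepsilon>0$ there exists a non-compact model surface of revolution $\widetilde M_\varepsilon^+=(\mathbb{R}^2,dt^2+m_\varepsilon^+(t)^2d\theta^2)$, with radial curvature $G_\varepsilon^+(t):=-m_\varepsilon^{+\,\prime\prime}(t)/m_\varepsilon^+(t)$, admitting a finite total curvature, such that $G_\varepsilon^+\ge K$ on $[0,\infty)$, $\|G_\varepsilon^+-K\|_2:=\sqrt{\int_0^\infty|G_\varepsilon^+-K|^2dt}<\varepsilon$, $\limsup_{t\to\infty}G_\varepsilon^+(t)=+\infty$, and $|c(\widetilde M)-c(\widetilde M_\varepsilon^+)|<\varepsilon$.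
   Context: A non-compact model surface of revolution is $\mathbb{R}^2$ with the metric $dt^2+m(t)^2d\theta^2$, where $(t,\theta)$ are polar coordinates about the origin and $m:(0,\infty)\to(0,\infty)$ is smooth, extends to a smooth odd function around $0$, and satisfies $m'(0)=1$. Its Gauss (radial) curvature is $-m''(t)/m(t)$. The total curvature of such a surface with Gauss curvature $G$ is $c:=\int G_+\,dA+\int G_-\,dA$ with $G_+=\max\{G,0\}$, $G_-=\min\{G,0\}$ and $dA$ the area element; it is finite if both integrals are finite. *)

(* Defs.v *)
From Stdlib Require Import Reals.
Open Scope R_scope.

Definition smooth (f : R -> R) : Prop :=
  exists D : nat -> R -> R,
    D O = f /\ forall (n : nat) (x : R), derivable_pt_lim (D n) x (D (S n) x).

(* A non-compact model surface of revolution (R^2, dt^2 + m(t)^2 dθ^2),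
   represented by the (unique) smooth odd extension of m to all of R:
   m is smooth, odd, m'(0) = 1, and m > 0 on (0, oo). *)
Definition model_surface (m : R -> R) : Prop :=
  smooth m /\
  (forall t : R, m (- t) = - m t) /\
  derivable_pt_lim m 0 1 /\
  (forall t : R, 0 < t -> 0 < m t).

Definition second_deriv (m m2 : R -> R) : Prop :=
  exists m1 : R -> R,
    (forall t : R, derivable_pt_lim m t (m1 t)) /\
    (forall t : R, derivable_pt_lim m1 t (m2 t)).

Definition radial_curv (m m2 : R -> R) (t : R) : R := - m2 t / m t.

Definition improper_int (f : R -> R) (l : R) : Prop :=
  (forall T : R, 0 <= T -> inhabited (Riemann_integrable f 0 T)) /\
  (forall eps : R, 0 < eps -> exists T0 : R,
     forall (T : R) (pr : Riemann_integrable f 0 T),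
       T0 <= T -> Rabs (RiemannInt pr - l) < eps).

(* Total curvature c = ∫ G_+ dA + ∫ G_- dA (both finite), with
   dA = m(t) dt dθ in geodesic polar coordinates. *)
Definition total_curvature (m m2 : R -> R) (c : R) : Prop :=
  exists cp cn : R,
    improper_int (fun t => 2 * PI * (Rmax (radial_curv m m2 t) 0 * m t)) cp /\
    improper_int (fun t => 2 * PI * (Rmin (radial_curv m m2 t) 0 * m t)) cn /\
    c = cp + cn.

(* Main.v *)
Require Import Defs.
From Stdlib Require Import Reals Lra Factorial ClassicalEpsilon FunctionalExtensionality.
From Coquelicot Require Import Coquelicot.
Open Scope R_scope.

(** Look for m = f u with u close to 1. Then G_m = K + h with
    (f^2 u')' = - h f^2 u, so instead of solving an ODE one prescribes the
    flux: for a nonnegative smooth g vanishing near 0, put v = int_0 g,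
    u = 1 - int_0 v / f^2, which gives h = g / (f^2 u). Since the total
    curvature is less than 2 pi, f' tends to a positive limit, so f grows
    linearly, 1 / f^2 is integrable at infinity, and u stays close to 1 when
    the integral of g is small. Take for g tall thin spikes at the integers:
    g = Y^3 / (1 + mu^2 Y(t+1)^16 sin^2(pi t)), cut off near 0, with Y a
    smooth increasing function dominating 1 + t and |f''|. The height Y^3
    beats |K| f^2 at the integers, whereas the integral of Y^3 g, which
    controls the change of total curvature and the L2 norm of h, is at most
    4 / mu. *)

(** * Smooth functions *)

(** A class of functions closed under differentiation consists of smooth functions: choosing a
    derivative inside the class again and again yields the whole sequence that [smooth] asks for.
    The recursion runs on functions paired with their membership proof, so that it can always
    continue. *)
Lemma smooth_coind (P : (R -> R) -> Prop) :
  (forall f, P f -> exists f', (forall x, is_derive f x (f' x)) /\ P f') ->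
  forall f, P f -> smooth f.
Proof.
intros HP f Pf.
pose (next := fun s : {h | P h} =>
  let e := constructive_indefinite_description _
             (HP (proj1_sig s) (proj2_sig s)) in
  exist P (proj1_sig e) (proj2 (proj2_sig e))).
pose (D := fix D n := match n with O => exist P f Pf | S n => next (D n) end).
exists (fun n => proj1_sig (D n)); split; [reflexivity|].
intros n x; apply is_derive_Reals.
change (D (S n)) with (next (D n)); unfold next; simpl.
destruct constructive_indefinite_description as [h [Hd Ph]]; simpl; apply Hd.
Qed.

(** [flat 0] is the classical function $e^{-1/x}$ extended by 0. The extra powers of $1/x$ make the
    span of the family closed under differentiation. *)
Definition flat (k : nat) (x : R) : R :=
  if Rlt_dec 0 x then (/ x) ^ k * exp (- / x) else 0.

Lemma flat_pos (k : nat) (x : R) : 0 < x -> flat k x = (/ x) ^ k * exp (- / x).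
Proof. intros Hx; unfold flat; destruct Rlt_dec; [reflexivity|lra]. Qed.

Lemma flat_nonpos (k : nat) (x : R) : x <= 0 -> flat k x = 0.
Proof. intros Hx; unfold flat; destruct Rlt_dec; [lra|reflexivity]. Qed.

Lemma exp_ge_pow_div (n : nat) (y : R) : 0 <= y -> y ^ n / INR (fact n) <= exp y.
Proof.
intros Hy.
apply Rle_trans with (sum_f_R0 (fun k => y ^ k / INR (fact k)) n).
- destruct n as [|n]; [simpl; lra|].
  rewrite tech5; apply Rle_trans with (0 + y ^ S n / INR (fact (S n))); [lra|].
  apply Rplus_le_compat_r, cond_pos_sum; intros k.
  apply Rmult_le_pos; [now apply pow_le|].
  apply Rlt_le, Rinv_0_lt_compat, INR_fact_lt_0.
- now apply exp_ge_taylor.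
Qed.

(** The Taylor bound $e^y \ge y^{k+2}/(k+2)!$ at $y = 1/x$ beats $x^{-k}$ with two powers to spare.
    A quadratic bound is all that differentiability at 0 with derivative 0 requires. *)
Lemma flat_le_sqr (k : nat) (x : R) : Rabs (flat k x) <= INR (fact (k + 2)) * x ^ 2.
Proof.
assert (Hf : 0 < INR (fact (k + 2))) by apply INR_fact_lt_0.
destruct (Rlt_le_dec 0 x) as [Hx|Hx].
- rewrite flat_pos by easy.
  assert (Hi : 0 < / x) by now apply Rinv_0_lt_compat.
  assert (Hp : 0 < (/ x) ^ k) by now apply pow_lt.
  rewrite Rabs_right by (apply Rle_ge, Rmult_le_pos; [lra|apply Rlt_le, exp_pos]).
  pose proof (exp_ge_pow_div (k + 2) (/ x) (Rlt_le _ _ Hi)) as H.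
  rewrite exp_Ropp.
  apply Rle_div_l; [apply exp_pos|].
  apply Rle_div_l in H; [|lra].
  rewrite pow_add in H.
  replace ((/ x) ^ k) with ((/ x) ^ k * (/ x) ^ 2 * x ^ 2) by (field; lra).
  assert (0 < x ^ 2) by (apply pow_lt; lra).
  nra.
- rewrite flat_nonpos, Rabs_R0 by easy.
  apply Rmult_le_pos; [lra|apply pow2_ge_0].
Qed.

Lemma is_derive_at_0_of_le_sqr (f : R -> R) (C : R) :
  f 0 = 0 -> (forall x, Rabs (f x) <= C * x ^ 2) -> is_derive f 0 0.
Proof.
intros Hf0 Hf; apply is_derive_Reals; intros eps Heps.
assert (HC : 0 < Rabs C + 1) by (pose proof (Rabs_pos C); lra).
exists (mkposreal _ (Rdiv_lt_0_compat _ _ Heps HC)); simpl; intros h Hh Hhd.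
rewrite Rplus_0_l, Hf0, !Rminus_0_r.
apply (Rlt_div_r (Rabs h) eps _ HC) in Hhd.
unfold Rdiv; rewrite Rabs_mult, Rabs_inv.
assert (Hp : 0 < Rabs h) by now apply Rabs_pos_lt.
apply (Rlt_div_l (Rabs (f h)) eps (Rabs h) Hp).
specialize (Hf h).
replace (h ^ 2) with (Rabs h * Rabs h) in Hf by (rewrite <- Rabs_mult, Rabs_right; nra).
pose proof (Rle_abs C).
nra.
Qed.

Lemma flat_derive (k : nat) (x : R) :
  is_derive (flat k) x (flat (k + 2) x + - INR k * flat (k + 1) x).
Proof.
destruct (Rtotal_order x 0) as [Hx|[->|Hx]].
- rewrite !flat_nonpos by lra.
  replace (0 + - INR k * 0) with 0 by ring.
  apply (is_derive_ext_loc (fun _ => 0)); [|apply @is_derive_const].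
  exists (mkposreal (- x) ltac:(lra)); intros y Hy.
  apply Rabs_lt_between' in Hy; simpl in Hy; rewrite flat_nonpos; lra.
- rewrite !flat_nonpos by lra.
  replace (0 + - INR k * 0) with 0 by ring.
  apply is_derive_at_0_of_le_sqr with (INR (fact (k + 2))).
  + apply flat_nonpos; lra.
  + apply flat_le_sqr.
- apply (is_derive_ext_loc (fun y => (/ y) ^ k * exp (- / y))).
  + exists (mkposreal x Hx); intros y Hy.
    apply Rabs_lt_between' in Hy; simpl in Hy; symmetry; apply flat_pos; lra.
  + rewrite !flat_pos by lra.
    auto_derive; [lra|].
    rewrite !pow_add; destruct k as [|k]; simpl pred; [simpl; field; lra|].
    rewrite S_INR; simpl; field; lra.
Qed.

Lemma flat_ge0 (k : nat) (x : R) : 0 <= flat k x.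
Proof.
destruct (Rlt_le_dec 0 x) as [Hx|Hx].
- rewrite flat_pos by easy; apply Rmult_le_pos; [|apply Rlt_le, exp_pos].
  apply pow_le, Rlt_le, Rinv_0_lt_compat, Hx.
- rewrite flat_nonpos; lra.
Qed.

Lemma flat0_le1 (x : R) : flat 0 x <= 1.
Proof.
destruct (Rlt_le_dec 0 x) as [Hx|Hx]; [|rewrite flat_nonpos; lra].
rewrite flat_pos by easy; simpl; rewrite Rmult_1_l, <- exp_0.
apply Rlt_le, exp_increasing.
pose proof (Rinv_0_lt_compat x Hx); lra.
Qed.

Lemma flat0_ge (x : R) : 1 / 2 <= x -> exp (- 2) <= flat 0 x.
Proof.
intros Hx; rewrite flat_pos by lra; simpl; rewrite Rmult_1_l.
assert (/ x <= 2).
{ replace 2 with (/ (1 / 2)) by field; apply Rinv_le_contravar; lra. }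
destruct (Req_dec (/ x) 2) as [->|]; [apply Rle_refl|apply Rlt_le, exp_increasing; lra].
Qed.

(** Smoothness is derived syntactically: this class is closed under differentiation, so
    [smooth_coind] applies to it, and no formula for higher derivatives of products, inverses or
    compositions is needed. The constructor [sc_prim] accommodates functions defined by
    integrals. *)
Inductive smooth_closure : (R -> R) -> Prop :=
| sc_smooth f : smooth f -> smooth_closure f
| sc_flat k : smooth_closure (flat k)
| sc_plus f g : smooth_closure f -> smooth_closure g ->
    smooth_closure (fun x => f x + g x)
| sc_mult f g : smooth_closure f -> smooth_closure g ->
    smooth_closure (fun x => f x * g x)
| sc_inv f : smooth_closure f -> (forall x, f x <> 0) ->
    smooth_closure (fun x => / f x)
| sc_comp f g : smooth_closure f -> smooth_closure g ->
    smooth_closure (fun x => f (g x))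
| sc_prim f f' : (forall x, is_derive f x (f' x)) -> smooth_closure f' ->
    smooth_closure f.

Lemma smooth_const (c : R) : smooth (fun _ => c).
Proof.
apply (smooth_coind (fun h => exists c, h = fun _ => c)); [|now exists c].
intros h [d ->]; exists (fun _ => 0); split; [|now exists 0].
intros x; apply @is_derive_const.
Qed.

Lemma smooth_closure_derive f : smooth_closure f ->
  exists f', (forall x, is_derive f x (f' x)) /\ smooth_closure f'.
Proof.
induction 1 as [f Hf|k|f g _ [f' [Hf Sf]] _ [g' [Hg Sg]]
  |f g Hf0 [f' [Hf Sf]] Hg0 [g' [Hg Sg]]|f Hf0 [f' [Hf Sf]] Hn
  |f g Hf0 [f' [Hf Sf]] Hg0 [g' [Hg Sg]]|f f' Hf Hf' _].
- destruct Hf as [D [<- HD]].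
  exists (D 1%nat); split; [intros x; apply is_derive_Reals, HD|].
  apply sc_smooth; exists (fun n => D (S n)); split; [easy|intros; apply HD].
- exists (fun x => flat (k + 2) x + - INR k * flat (k + 1) x); split.
  + apply flat_derive.
  + apply sc_plus; [apply sc_flat|].
    apply sc_mult; [apply sc_smooth, smooth_const|apply sc_flat].
- exists (fun x => f' x + g' x); split; [|now apply sc_plus].
  intros x; now apply @is_derive_plus.
- exists (fun x => f' x * g x + f x * g' x); split.
  + intros x; apply (is_derive_mult f g); [easy|easy|intros; apply Rmult_comm].
  + now apply sc_plus; apply sc_mult.
(* The derivative $-f'/f^2$ is written with products and inverses only, so that the constructors
   apply to it. *)
- exists (fun x => (-1 * f' x) * (/ f x * / f x)); split.
  + intros x; replace (-1 * f' x * (/ f x * / f x)) with (- f' x / f x ^ 2)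
      by (field; apply Hn).
    now apply is_derive_inv.
  + apply sc_mult; apply sc_mult; try apply sc_inv; try easy.
    apply sc_smooth, smooth_const.
- exists (fun x => g' x * f' (g x)); split.
  + intros x; now apply (is_derive_comp f g).
  + apply sc_mult; [easy|now apply sc_comp].
- now exists f'.
Qed.

Lemma smooth_closure_smooth f : smooth_closure f -> smooth f.
Proof. apply smooth_coind, smooth_closure_derive. Qed.

Lemma smooth_id : smooth (fun x => x).
Proof.
apply smooth_closure_smooth, sc_prim with (fun _ => 1).
- intros x; apply @is_derive_id.
- apply sc_smooth, smooth_const.
Qed.

Lemma smooth_sin : smooth sin.
Proof.
apply (smooth_coind (fun h => exists a b, h = fun x => a * sin x + b * cos x)).
- intros h [a [b ->]]; exists (fun x => - b * sin x + a * cos x); split.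
  + intros x; auto_derive; [easy|ring].
  + now exists (- b), a.
- exists 1, 0; apply functional_extensionality; intros x; ring.
Qed.

Lemma smooth_closure_pow f n : smooth_closure f -> smooth_closure (fun x => f x ^ n).
Proof.
intros Hf; induction n as [|n IH]; [apply sc_smooth, (smooth_const 1)|].
now apply (sc_mult f (fun x => f x ^ n)).
Qed.

Lemma smooth_closure_affine a b : smooth_closure (fun x => a * x + b).
Proof.
apply sc_plus; [|apply sc_smooth, smooth_const].
apply sc_mult; apply sc_smooth; [apply smooth_const|apply smooth_id].
Qed.

Lemma smooth_closure_continuous f x : smooth_closure f -> continuous f x.
Proof.
intros Hf; destruct (smooth_closure_derive f Hf) as [f' [Hf' _]].
apply @ex_derive_continuous; now exists (f' x).
Qed.

(** * Integration on the half-line *)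

Lemma le_of_derive_ge0 (f df : R -> R) (a b : R) : a <= b ->
  (forall x, a <= x <= b -> is_derive f x (df x)) ->
  (forall x, a <= x <= b -> 0 <= df x) -> f a <= f b.
Proof.
intros Hab Hd Hp.
destruct (MVT_gen f a b df) as [c [Hc Heq]].
- intros x Hx; rewrite Rmin_left, Rmax_right in Hx by easy; apply Hd; lra.
- intros x Hx; rewrite Rmin_left, Rmax_right in Hx by easy.
  apply derivable_continuous_pt; exists (df x); now apply is_derive_Reals, Hd.
- rewrite Rmin_left, Rmax_right in Hc by easy.
  specialize (Hp c Hc); nra.
Qed.

Lemma ex_RInt_of_continuous (f : R -> R) (a b : R) :
  (forall x, continuous f x) -> ex_RInt f a b.
Proof. intros Hf; apply @ex_RInt_continuous; intros; apply Hf. Qed.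

Lemma is_derive_primitive (g : R -> R) (x : R) :
  (forall y, continuous g y) -> is_derive (RInt g 0) x (g x).
Proof.
intros Hg; apply @is_derive_RInt with 0; [|apply Hg].
apply filter_forall; intros y; apply @RInt_correct.
now apply ex_RInt_of_continuous.
Qed.

Lemma RInt_eq0 (g : R -> R) (a b : R) :
  (forall x, Rmin a b < x < Rmax a b -> g x = 0) -> RInt g a b = 0.
Proof.
intros Hg; rewrite (RInt_ext g (fun _ => 0)) by easy.
rewrite RInt_const; unfold scal; simpl; unfold mult; simpl; ring.
Qed.

Lemma RInt_le_of_derive_ge (g G dG : R -> R) (a b : R) : a <= b ->
  ex_RInt g a b -> (forall x, a <= x <= b -> is_derive G x (dG x)) ->
  (forall x, a <= x <= b -> continuous dG x) ->
  (forall x, a < x < b -> g x <= dG x) -> RInt g a b <= G b - G a.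
Proof.
intros Hab Hg HG Hc Hle.
assert (HI : is_RInt dG a b (G b - G a)).
{ apply (is_RInt_derive G dG); intros x Hx;
    rewrite Rmin_left, Rmax_right in Hx by easy; [now apply HG|now apply Hc]. }
rewrite <- (is_RInt_unique _ _ _ _ HI).
apply RInt_le; [easy|easy|now exists (G b - G a)|easy].
Qed.

Lemma RInt_mono_end (p : R -> R) (a b : R) : 0 <= a <= b ->
  (forall T, 0 <= T -> ex_RInt p 0 T) -> (forall t, 0 < t -> 0 <= p t) ->
  RInt p 0 a <= RInt p 0 b.
Proof.
intros Hab Hi Hp.
assert (Hi2 : ex_RInt p a b) by (apply @ex_RInt_Chasles_2 with 0; [lra|apply Hi; lra]).
rewrite <- (RInt_Chasles p 0 a b) by (try apply Hi; try easy; lra).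
assert (0 <= RInt p a b).
{ apply RInt_ge_0; [lra|easy|intros; apply Hp; lra]. }
unfold plus; simpl; lra.
Qed.

Lemma improper_int_iff (p : R -> R) (l : R) : improper_int p l <->
  (forall T, 0 <= T -> ex_RInt p 0 T) /\
  (forall eps, 0 < eps -> exists T0, 0 <= T0 /\
     forall T, T0 <= T -> Rabs (RInt p 0 T - l) < eps).
Proof.
split; intros [Hi Hl].
- assert (Hi' : forall T, 0 <= T -> ex_RInt p 0 T).
  { intros T HT; destruct (Hi T HT) as [pr]; now apply ex_RInt_Reals_1. }
  split; [easy|]; intros eps Heps; destruct (Hl eps Heps) as [T0 HT0].
  exists (Rmax 0 T0); split; [apply Rmax_l|]; intros T HT.
  pose proof (Rmax_l 0 T0); pose proof (Rmax_r 0 T0).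
  rewrite (RInt_Reals _ _ _ (ex_RInt_Reals_0 _ _ _ (Hi' T ltac:(lra)))).
  apply HT0; lra.
- split.
  + intros T HT; constructor; apply ex_RInt_Reals_0, Hi, HT.
  + intros eps Heps; destruct (Hl eps Heps) as [T0 [_ HT0]].
    exists T0; intros T pr HT; rewrite <- RInt_Reals; now apply HT0.
Qed.

Lemma improper_int_ext (p q : R -> R) (l : R) :
  (forall t, 0 < t -> p t = q t) -> improper_int p l -> improper_int q l.
Proof.
intros Hpq; rewrite !improper_int_iff; intros [Hi Hl]; split.
- intros T HT; apply (@ex_RInt_ext _ p); [|now apply Hi].
  intros x; rewrite Rmin_left, Rmax_right by lra; intros; apply Hpq; lra.
- intros eps Heps; destruct (Hl eps Heps) as [T0 [H0 HT0]].
  exists T0; split; [easy|]; intros T HT.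
  rewrite <- (RInt_ext p); [now apply HT0|].
  intros x; rewrite Rmin_left, Rmax_right by lra; intros; apply Hpq; lra.
Qed.

Lemma improper_int_lin (p q : R -> R) (a b lp lq : R) :
  improper_int p lp -> improper_int q lq ->
  improper_int (fun t => a * p t + b * q t) (a * lp + b * lq).
Proof.
rewrite !improper_int_iff; intros [Hip Hlp] [Hiq Hlq].
assert (Hs : forall T, 0 <= T ->
  is_RInt (fun t => a * p t + b * q t) 0 T (a * RInt p 0 T + b * RInt q 0 T)).
{ intros T HT.
  apply (is_RInt_plus (fun t => a * p t) (fun t => b * q t)).
  - apply (is_RInt_scal p), @RInt_correct, Hip, HT.
  - apply (is_RInt_scal q), @RInt_correct, Hiq, HT. }
split; [intros T HT; eexists; now apply Hs|].
intros eps Heps.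
assert (Ha := Rabs_pos a); assert (Hb := Rabs_pos b).
assert (He : 0 < eps / (Rabs a + Rabs b + 1)) by (apply Rdiv_lt_0_compat; lra).
destruct (Hlp _ He) as [T1 [HT1 H1]]; destruct (Hlq _ He) as [T2 [HT2 H2]].
exists (Rmax T1 T2); split; [pose proof (Rmax_l T1 T2); lra|]; intros T HT.
pose proof (Rmax_l T1 T2); pose proof (Rmax_r T1 T2).
specialize (H1 T ltac:(lra)); specialize (H2 T ltac:(lra)).
rewrite (is_RInt_unique _ _ _ _ (Hs T ltac:(lra))).
replace (_ - _) with (a * (RInt p 0 T - lp) + b * (RInt q 0 T - lq)) by ring.
eapply Rle_lt_trans; [apply Rabs_triang|]; rewrite !Rabs_mult.
set (d := eps / (Rabs a + Rabs b + 1)) in *.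
assert (Hd : eps = d * (Rabs a + Rabs b + 1)) by (unfold d; field; lra).
rewrite Hd; nra.
Qed.

Lemma improper_int_le_limit (p : R -> R) (l T : R) : 0 <= T ->
  (forall t, 0 < t -> 0 <= p t) -> improper_int p l -> RInt p 0 T <= l.
Proof.
rewrite improper_int_iff; intros HT Hp [Hi Hl].
apply Rnot_lt_le; intros Hlt.
destruct (Hl (RInt p 0 T - l) ltac:(lra)) as [T0 [H0 HT0]].
specialize (HT0 (Rmax T T0) (Rmax_r _ _)).
pose proof (RInt_mono_end p T (Rmax T T0) (conj HT (Rmax_l _ _)) Hi Hp).
apply Rabs_lt_between in HT0; lra.
Qed.

Lemma improper_int_bound (p : R -> R) (l M : R) : improper_int p l ->
  (forall T, 0 <= T -> Rabs (RInt p 0 T) <= M) -> Rabs l <= M.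
Proof.
rewrite improper_int_iff; intros [Hi Hl] HM.
apply Rnot_lt_le; intros Hlt.
destruct (Hl (Rabs l - M) ltac:(lra)) as [T0 [H0 HT0]].
specialize (HT0 T0 (Rle_refl _)); specialize (HM T0 H0).
pose proof (Rabs_triang_inv l (RInt p 0 T0)) as H.
rewrite Rabs_minus_sym in H; lra.
Qed.

Lemma improper_int_of_bounded (p : R -> R) (M : R) :
  (forall T, 0 <= T -> ex_RInt p 0 T) -> (forall t, 0 < t -> 0 <= p t) ->
  (forall T, 0 <= T -> RInt p 0 T <= M) ->
  exists l, improper_int p l /\ l <= M.
Proof.
intros Hi Hp HM.
destruct (completeness (fun y => exists T, 0 <= T /\ y = RInt p 0 T)) as [l [Hub Hlub]].
- exists M; intros y [T [HT ->]]; now apply HM.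
- exists (RInt p 0 0), 0; split; lra.
- exists l; split.
  + apply improper_int_iff; split; [easy|]; intros eps Heps.
    destruct (classic (exists T, 0 <= T /\ l - eps < RInt p 0 T)) as [[T0 [H0 HT0]]|Hn].
    * exists T0; split; [easy|]; intros T HT.
      pose proof (RInt_mono_end p T0 T (conj H0 HT) Hi Hp).
      assert (RInt p 0 T <= l) by (apply Hub; exists T; split; lra).
      apply Rabs_lt_between; lra.
    * exfalso.
      assert (l <= l - eps); [|lra].
      apply Hlub; intros y [T [HT ->]]; apply Rnot_lt_le; intros Hlt.
      apply Hn; now exists T.
  + apply Hlub; intros y [T [HT ->]]; now apply HM.
Qed.

(** Write $d = (e + d) - e$. Both terms are nonnegative with bounded partial integrals, hence
    converge by monotonicity; the bound on the limit comes from the partial integrals of $d$. *)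
Lemma improper_int_dominated (d e : R -> R) (E : R) :
  (forall T, 0 <= T -> ex_RInt d 0 T) -> (forall T, 0 <= T -> ex_RInt e 0 T) ->
  (forall t, 0 < t -> Rabs (d t) <= e t) ->
  (forall T, 0 <= T -> RInt e 0 T <= E) ->
  exists l, improper_int d l /\ Rabs l <= E.
Proof.
intros Hd He Hde HE.
assert (Hp : forall t, 0 < t -> 0 <= e t).
{ intros t Ht; specialize (Hde t Ht); pose proof (Rabs_pos (d t)); lra. }
assert (Habs : forall T, 0 <= T -> Rabs (RInt d 0 T) <= E).
{ intros T HT; apply Rle_trans with (RInt e 0 T); [|now apply HE].
  apply Rabs_le_between; split.
  - rewrite <- (RInt_opp e) by (now apply He).
    apply RInt_le; [easy|apply @ex_RInt_opp, He, HT|now apply Hd|].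
    intros x Hx; specialize (Hde x ltac:(lra)); apply Rabs_le_between in Hde.
    unfold opp; simpl; lra.
  - apply RInt_le; [easy|now apply Hd|now apply He|].
    intros x Hx; specialize (Hde x ltac:(lra)); apply Rabs_le_between in Hde; lra. }
destruct (improper_int_of_bounded e E He Hp HE) as [le [Hle _]].
assert (Hsum : forall T, 0 <= T ->
  is_RInt (fun t => e t + d t) 0 T (RInt e 0 T + RInt d 0 T)).
{ intros T HT; apply (is_RInt_plus e d); apply @RInt_correct; [now apply He|now apply Hd]. }
destruct (improper_int_of_bounded (fun t => e t + d t) (E + E)) as [ls [Hls _]].
- intros T HT; eexists; now apply Hsum.
- intros t Ht; specialize (Hde t Ht); apply Rabs_le_between in Hde; lra.
- intros T HT; rewrite (is_RInt_unique _ _ _ _ (Hsum T HT)).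
  specialize (HE T HT); specialize (Habs T HT); apply Rabs_le_between in Habs; lra.
- assert (Hl : improper_int d (1 * ls + -1 * le)).
  { apply (improper_int_ext (fun t => 1 * (e t + d t) + -1 * e t)).
    - intros; ring.
    - now apply improper_int_lin. }
  exists (1 * ls + -1 * le); split; [easy|].
  now apply (improper_int_bound d).
Qed.

(** * Spikes at the integers *)

Lemma sin_PI_ge (t : R) : 0 <= t <= 1 / 2 -> t <= sin (PI * t).
Proof.
intros Ht; pose proof PI2_3_2; pose proof PI_4.
assert (H3 : 3 <= PI) by lra.
(* The bound $\sin x \ge x - x^3/6$ is at least $x/3$ for $0 \le x \le 2$, and $x = \pi t \ge
   3t$. *)
destruct (sin_bound (PI * t) 0) as [Hlb _]; [nra|nra|].
eapply Rle_trans; [|apply Hlb].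
unfold sin_approx, sin_term; simpl.
set (x := PI * t).
assert (Hx : 3 * t <= x <= 2) by (unfold x; nra).
field_simplify; nra.
Qed.

Lemma sin_PI_shift_sqr (n : nat) (s : R) :
  sin (PI * (s + INR n)) ^ 2 = sin (PI * s) ^ 2.
Proof.
induction n as [|n IH]; [simpl INR; now rewrite Rplus_0_r|].
rewrite <- IH, S_INR.
replace (PI * (s + (INR n + 1))) with (PI * (s + INR n) + PI) by ring.
rewrite neg_sin; ring.
Qed.

(** Since $|\sin \pi s|$ is at least the distance from $s$ to the nearer endpoint, the spike lies
    below the Lorentzian centred there. Adding both Lorentzians gives one bound on all of $[0,1]$,
    with an arctangent primitive. *)
Lemma inv_sin_spike_le (a s : R) : 0 <= s <= 1 ->
  / (1 + a ^ 2 * sin (PI * s) ^ 2) <=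
  / (1 + (a * s) ^ 2) + / (1 + (a * (s - 1)) ^ 2).
Proof.
intros Hs; assert (Ha := pow2_ge_0 a).
assert (H1 : 0 < / (1 + (a * s) ^ 2)).
{ apply Rinv_0_lt_compat; pose proof (pow2_ge_0 (a * s)); lra. }
assert (H2 : 0 < / (1 + (a * (s - 1)) ^ 2)).
{ apply Rinv_0_lt_compat; pose proof (pow2_ge_0 (a * (s - 1))); lra. }
destruct (Rle_dec s (1 / 2)) as [Hh|Hh].
- pose proof (sin_PI_ge s ltac:(lra)) as H.
  apply Rle_trans with (/ (1 + (a * s) ^ 2)); [|lra].
  apply Rinv_le_contravar; [pose proof (pow2_ge_0 (a * s)); lra|].
  rewrite Rpow_mult_distr.
  assert (s ^ 2 <= sin (PI * s) ^ 2) by (apply pow_incr; lra).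
  nra.
- pose proof (sin_PI_ge (1 - s) ltac:(lra)) as H.
  apply Rle_trans with (/ (1 + (a * (s - 1)) ^ 2)); [|lra].
  apply Rinv_le_contravar; [pose proof (pow2_ge_0 (a * (s - 1))); lra|].
  replace (PI * (1 - s)) with (PI - PI * s) in H by ring.
  rewrite sin_PI_x in H.
  rewrite Rpow_mult_distr; replace ((s - 1) ^ 2) with ((1 - s) ^ 2) by ring.
  assert ((1 - s) ^ 2 <= sin (PI * s) ^ 2) by (apply pow_incr; lra).
  nra.
Qed.

Lemma one_plus_sqr_neq0 (x : R) : 1 + x ^ 2 <> 0.
Proof. pose proof (pow2_ge_0 x); lra. Qed.

Lemma continuous_inv_sin_spike (a x : R) :
  continuous (fun t => / (1 + a ^ 2 * sin (PI * t) ^ 2)) x.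
Proof.
apply @ex_derive_continuous; auto_derive.
replace (1 + _) with (1 + (a * sin (PI * x)) ^ 2) by ring.
apply one_plus_sqr_neq0.
Qed.

Lemma RInt_inv_sin_spike (a : R) (n : nat) : 0 < a ->
  RInt (fun t => / (1 + a ^ 2 * sin (PI * t) ^ 2)) (INR n) (INR n + 1) <= 4 / a.
Proof.
intros Ha.
(* A primitive of the two Lorentzians; its increment is $2\arctan(a)/a < \pi/a \le 4/a$. *)
pose (G := fun x => (atan (a * (x - INR n)) + atan (a * (x - INR n - 1))) / a).
pose (dG := fun x => / (1 + (a * (x - INR n)) ^ 2) + / (1 + (a * (x - INR n - 1)) ^ 2)).
apply Rle_trans with (G (INR n + 1) - G (INR n)).
- apply RInt_le_of_derive_ge with dG.
  + lra.
  + apply ex_RInt_of_continuous; intros; apply continuous_inv_sin_spike.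
  + intros x _; unfold G, dG.
    pose proof (one_plus_sqr_neq0 (a * (x - INR n))).
    pose proof (one_plus_sqr_neq0 (a * (x - INR n - 1))).
    auto_derive; [easy|].
    unfold Rsqr; field; split; [|split]; [nra|nra|lra].
  + intros x _; unfold dG; apply @ex_derive_continuous.
    pose proof (one_plus_sqr_neq0 (a * (x - INR n))).
    pose proof (one_plus_sqr_neq0 (a * (x - INR n - 1))).
    auto_derive; repeat split; try easy; nra.
  + intros x Hx; unfold dG.
    replace (sin (PI * x) ^ 2) with (sin (PI * (x - INR n)) ^ 2).
    * apply inv_sin_spike_le; lra.
    * rewrite <- (sin_PI_shift_sqr n (x - INR n)); do 3 f_equal; ring.
- unfold G.
  replace (INR n + 1 - INR n) with 1 by ring.
  replace (INR n - INR n) with 0 by ring.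
  replace (1 - 1) with 0 by ring.
  replace (a * (0 - 1)) with (- a) by ring.
  rewrite Rmult_0_r, Rmult_1_r, atan_0, atan_opp.
  replace ((atan a + 0) / a - (0 + - atan a) / a) with (2 * atan a / a) by (field; lra).
  apply Rmult_le_compat_r; [apply Rlt_le, Rinv_0_lt_compat, Ha|].
  pose proof (atan_bound a); pose proof PI_4; lra.
Qed.

Section Spikes.
Variables (Y : R -> R) (mu : R).
Hypothesis mu_pos : 0 < mu.
Hypothesis Y_smooth : smooth_closure Y.
Hypothesis Y_mono : forall s t, 0 <= s <= t -> Y s <= Y t.
Hypothesis Y_ge : forall t, 0 <= t -> 1 + t <= Y t.

(* The argument [t + 1] makes the sharpness of the spike on [n, n+1] dominate
   its height there, however fast [Y] grows. *)
Definition spikes (t : R) : R :=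
  flat 0 (t - 1 / 2) *
  (Y t ^ 3 * / (1 + (mu * Y (t + 1) ^ 8 * sin (PI * t)) ^ 2)).

Lemma spikes_smooth : smooth_closure spikes.
Proof.
assert (H1 : forall b, smooth_closure (fun t => t + b)).
{ intros b; replace (fun t => t + b) with (fun t => 1 * t + b).
  - apply smooth_closure_affine.
  - apply functional_extensionality; intros; ring. }
apply sc_mult; [apply (sc_comp (flat 0)); [apply sc_flat|apply H1]|].
apply sc_mult; [now apply smooth_closure_pow|].
apply sc_inv; [|intros; apply one_plus_sqr_neq0].
apply sc_plus; [apply sc_smooth, smooth_const|].
apply (smooth_closure_pow (fun t => mu * Y (t + 1) ^ 8 * sin (PI * t))).
apply sc_mult.
- apply sc_mult; [apply sc_smooth, smooth_const|].
  apply (smooth_closure_pow (fun t => Y (t + 1))), (sc_comp Y); [easy|apply H1].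
- apply (sc_comp sin); [apply sc_smooth, smooth_sin|].
  apply sc_mult; apply sc_smooth; [apply smooth_const|apply smooth_id].
Qed.

Lemma spikes_eq0 (t : R) : t <= 1 / 2 -> spikes t = 0.
Proof. intros Ht; unfold spikes; rewrite flat_nonpos by lra; ring. Qed.

Lemma inv_one_plus_sqr_bounds (x : R) : 0 < / (1 + x ^ 2) <= 1.
Proof.
pose proof (pow2_ge_0 x); split; [apply Rinv_0_lt_compat; lra|].
rewrite <- Rinv_1 at 2; apply Rinv_le_contravar; lra.
Qed.

Lemma spikes_bounds (t : R) : 0 <= t -> 0 <= spikes t <= Y t ^ 3.
Proof.
intros Ht; unfold spikes.
pose proof (inv_one_plus_sqr_bounds (mu * Y (t + 1) ^ 8 * sin (PI * t))).
pose proof (flat_ge0 0 (t - 1 / 2)); pose proof (flat0_le1 (t - 1 / 2)).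
assert (0 <= Y t ^ 3) by (apply pow_le; specialize (Y_ge t Ht); lra).
set (i := / _) in *; set (s := flat _ _) in *.
assert (0 <= Y t ^ 3 * i <= Y t ^ 3) by nra.
nra.
Qed.

Lemma spikes_ge0 (t : R) : 0 <= spikes t.
Proof.
destruct (Rle_dec 0 t) as [Ht|Ht]; [now apply spikes_bounds|].
rewrite spikes_eq0; lra.
Qed.

(** The sine vanishes at integers, so only the cutoff reduces the height $Y^3$, and at $n - 1/2 \ge
    1/2$ the cutoff is at least $e^{-2}$. *)
Lemma spikes_INR (n : nat) : (1 <= n)%nat ->
  exp (- 2) * Y (INR n) ^ 3 <= spikes (INR n).
Proof.
intros Hn; unfold spikes.
assert (H1 : 1 <= INR n) by (apply (le_INR 1), Hn).
assert (Hs : sin (PI * INR n) ^ 2 = 0).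
{ rewrite <- (Rplus_0_l (INR n)), sin_PI_shift_sqr, Rmult_0_r, sin_0; ring. }
rewrite Rpow_mult_distr, Hs, Rmult_0_r, Rplus_0_r, Rinv_1, Rmult_1_r.
apply Rmult_le_compat_r; [|apply flat0_ge; lra].
apply pow_le; specialize (Y_ge (INR n)); lra.
Qed.

Lemma weighted_spikes_continuous (x : R) :
  continuous (fun t => Y t ^ 3 * spikes t) x.
Proof.
apply smooth_closure_continuous, sc_mult; [|apply spikes_smooth].
now apply smooth_closure_pow.
Qed.

(** With $y = Y(n+1)$, on $[n,n+1]$ the weight times the height is at most $y^6$ and the sharpness
    is at least $\mu y^8$, so the integral is at most $4/(\mu y^2)$. As $y \ge n+2$, this is below a
    telescoping term. *)
Lemma RInt_weighted_spikes_unit (n : nat) :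
  RInt (fun t => Y t ^ 3 * spikes t) (INR n) (INR n + 1) <=
  4 / mu * (/ (INR n + 1) - / (INR n + 2)).
Proof.
assert (Hn := pos_INR n).
set (y := Y (INR n + 1)).
assert (Hy : INR n + 2 <= y) by (pose proof (Y_ge (INR n + 1)); unfold y; lra).
assert (Hy8 : 0 < y ^ 8) by (apply pow_lt; lra).
assert (Hy6 : 0 <= y ^ 6) by (apply pow_le; lra).
assert (Ha : 0 < mu * y ^ 8) by (apply Rmult_lt_0_compat; lra).
set (k := fun t => / (1 + (mu * y ^ 8) ^ 2 * sin (PI * t) ^ 2)).
assert (Hk : ex_RInt k (INR n) (INR n + 1)).
{ apply ex_RInt_of_continuous; intros; apply continuous_inv_sin_spike. }
apply Rle_trans with (y ^ 6 * RInt k (INR n) (INR n + 1)).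
- rewrite <- (RInt_scal k) by easy.
  apply RInt_le; [lra|apply ex_RInt_of_continuous, weighted_spikes_continuous| |].
  + now apply @ex_RInt_scal.
  + intros x Hx; change (Y x ^ 3 * spikes x <= y ^ 6 * k x); unfold k, spikes.
    assert (Hx1 : 0 <= Y x <= y).
    { split; [pose proof (Y_ge x); lra|apply Y_mono; lra]. }
    (* The shift in the definition of [spikes] pays off here: the sharpness anywhere on the interval
       dominates the height at its right end. *)
    assert (Hx2 : y <= Y (x + 1)) by (apply Y_mono; lra).
    set (i := / (1 + (mu * Y (x + 1) ^ 8 * sin (PI * x)) ^ 2)).
    assert (Hi : 0 < i <= / (1 + (mu * y ^ 8) ^ 2 * sin (PI * x) ^ 2)).
    { split; [apply inv_one_plus_sqr_bounds|].
      assert (Hs := pow2_ge_0 (sin (PI * x))).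
      apply Rinv_le_contravar.
      - pose proof (pow2_ge_0 (mu * y ^ 8)); nra.
      - rewrite (Rpow_mult_distr _ (sin _)).
        apply Rplus_le_compat_l, Rmult_le_compat_r; [easy|].
        apply pow_incr; split; [lra|].
        apply Rmult_le_compat_l; [lra|apply pow_incr; lra]. }
    pose proof (flat_ge0 0 (x - 1 / 2)); pose proof (flat0_le1 (x - 1 / 2)).
    assert (H3 : 0 <= Y x ^ 3 <= y ^ 3).
    { split; [apply pow_le; lra|apply pow_incr; lra]. }
    set (s := flat _ _) in *; set (j := / (1 + (mu * y ^ 8) ^ 2 * _)) in *.
    replace (y ^ 6) with (y ^ 3 * y ^ 3) by ring.
    assert (H6 : 0 <= Y x ^ 3 * Y x ^ 3 <= y ^ 3 * y ^ 3) by nra.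
    replace (Y x ^ 3 * (s * (Y x ^ 3 * i))) with (Y x ^ 3 * Y x ^ 3 * (s * i)) by ring.
    assert (Hsi : 0 <= s * i <= j) by nra.
    apply Rmult_le_compat; [apply H6|apply Hsi|apply H6|apply Hsi].
- apply Rle_trans with (y ^ 6 * (4 / (mu * y ^ 8))).
  + apply Rmult_le_compat_l; [easy|now apply RInt_inv_sin_spike].
  + replace (y ^ 6 * (4 / (mu * y ^ 8))) with (4 / mu * / y ^ 2) by (field; lra).
    apply Rmult_le_compat_l; [apply Rlt_le, Rdiv_lt_0_compat; lra|].
    replace (/ (INR n + 1) - / (INR n + 2)) with (/ ((INR n + 1) * (INR n + 2)))
      by (field; lra).
    apply Rinv_le_contravar; nra.
Qed.

Lemma RInt_weighted_spikes (T : R) : 0 <= T ->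
  RInt (fun t => Y t ^ 3 * spikes t) 0 T <= 4 / mu.
Proof.
intros HT.
assert (Hi : forall a b, ex_RInt (fun t => Y t ^ 3 * spikes t) a b).
{ intros; apply ex_RInt_of_continuous, weighted_spikes_continuous. }
assert (Hm : 0 < 4 / mu) by (apply Rdiv_lt_0_compat; lra).
assert (HN : forall n, RInt (fun t => Y t ^ 3 * spikes t) 0 (INR n) <=
                       4 / mu * (1 - / (INR n + 1))).
{ induction n as [|n IH].
  - simpl INR; rewrite RInt_point; unfold zero; simpl.
    rewrite Rplus_0_l, Rinv_1; lra.
  - rewrite S_INR, <- (RInt_Chasles _ 0 (INR n)) by apply Hi.
    pose proof (RInt_weighted_spikes_unit n) as Hu.
    replace (INR n + 1 + 1) with (INR n + 2) by ring.
    unfold plus; simpl plus; simpl in *; nra. }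
destruct (INR_unbounded T) as [N Ha].
eapply Rle_trans; [apply (RInt_mono_end _ T (INR N)); [lra|intros; apply Hi|]|].
- intros t Ht; apply Rmult_le_pos; [|apply spikes_ge0].
  apply pow_le; specialize (Y_ge t); lra.
- eapply Rle_trans; [apply HN|].
  assert (0 < / (INR N + 1)) by (apply Rinv_0_lt_compat; pose proof (pos_INR N); lra).
  nra.
Qed.

End Spikes.

(** * Surfaces with finite total curvature less than 2 pi *)

Lemma smooth_second_deriv (f f1 f2 : R -> R) : smooth f ->
  (forall x, is_derive f x (f1 x)) -> (forall x, is_derive f1 x (f2 x)) ->
  smooth f2.
Proof.
intros [D [<- HD]] H1 H2.
assert (E1 : D 1%nat = f1).
{ apply functional_extensionality; intros x.
  rewrite <- (is_derive_unique _ _ _ (H1 x)); symmetry.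
  apply is_derive_unique, is_derive_Reals, HD. }
assert (E2 : D 2%nat = f2).
{ apply functional_extensionality; intros x.
  rewrite <- (is_derive_unique _ _ _ (H2 x)); symmetry.
  rewrite <- E1; apply is_derive_unique, is_derive_Reals, HD. }
exists (fun n => D (S (S n))); split; [easy|intros; apply HD].
Qed.

Lemma continuous_lin_abs (h : R -> R) (a b x : R) :
  continuous h x -> continuous (fun t => a * h t + b * Rabs (h t)) x.
Proof.
intros Hh; apply (continuous_plus (fun t => a * h t) (fun t => b * Rabs (h t))).
- now apply (continuous_scal_r a h).
- apply (continuous_scal_r b (fun t => Rabs (h t))).
  apply (continuous_comp h Rabs); [easy|apply continuous_Rabs].
Qed.

(** Since $G m = -m''$, the integrand is $2\pi\max(-m'',0)$. The form on the right has no division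
    by $m$, hence is continuous at 0 as well whenever $m''$ is, and differs from the negative part
    only in the sign of $|m''|$. *)
Lemma curvature_pos_part (m m2 : R -> R) (t : R) : 0 < m t ->
  2 * PI * (Rmax (radial_curv m m2 t) 0 * m t) = - PI * m2 t + PI * Rabs (m2 t).
Proof.
intros Hm; unfold radial_curv.
assert (E : - m2 t / m t * m t = - m2 t) by (field; lra).
destruct (Rle_dec 0 (- m2 t / m t)) as [H|H].
- rewrite Rmax_left, E by easy.
  rewrite Rabs_left1 by nra; ring.
- rewrite Rmax_right by lra.
  rewrite Rabs_right by nra; ring.
Qed.

Lemma curvature_neg_part (m m2 : R -> R) (t : R) : 0 < m t ->
  2 * PI * (Rmin (radial_curv m m2 t) 0 * m t) = - PI * m2 t + - PI * Rabs (m2 t).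
Proof.
intros Hm; unfold radial_curv.
assert (E : - m2 t / m t * m t = - m2 t) by (field; lra).
destruct (Rle_dec 0 (- m2 t / m t)) as [H|H].
- rewrite Rmin_right by easy.
  rewrite Rabs_left1 by nra; ring.
- rewrite Rmin_left, E by lra.
  rewrite Rabs_right by nra; ring.
Qed.

Lemma total_curvature_iff (m m2 : R -> R) (c : R) : (forall t, 0 < t -> 0 < m t) ->
  total_curvature m m2 c <->
  exists cp cn,
    improper_int (fun t => - PI * m2 t + PI * Rabs (m2 t)) cp /\
    improper_int (fun t => - PI * m2 t + - PI * Rabs (m2 t)) cn /\ c = cp + cn.
Proof.
intros Hm; split; intros [cp [cn [Hp [Hn Hc]]]]; exists cp, cn;
  (split; [|split; [|easy]]).
- revert Hp; apply improper_int_ext; intros; now apply curvature_pos_part, Hm.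
- revert Hn; apply improper_int_ext; intros; now apply curvature_neg_part, Hm.
- revert Hp; apply improper_int_ext; intros; symmetry; now apply curvature_pos_part, Hm.
- revert Hn; apply improper_int_ext; intros; symmetry; now apply curvature_neg_part, Hm.
Qed.

Lemma RInt_abs_second_deriv_bounded (f f2 : R -> R) (c : R) :
  (forall t, 0 < t -> 0 < f t) -> total_curvature f f2 c ->
  exists A, 0 <= A /\ forall T, 0 <= T -> RInt (fun t => Rabs (f2 t)) 0 T <= A.
Proof.
intros Hf Hc; apply total_curvature_iff in Hc; [|easy].
destruct Hc as [cp [cn [Hp [Hn _]]]].
pose proof PI_RGT_0 as HPI.
(* Subtracting the two parts cancels $m''$ and leaves $2\pi\int |f''|$. *)
pose (A := / (2 * PI) * cp + - / (2 * PI) * cn).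
assert (HA : improper_int (fun t => Rabs (f2 t)) A).
{ eapply improper_int_ext; [|apply (improper_int_lin _ _ (/ (2 * PI)) (- / (2 * PI)) _ _ Hp Hn)].
  intros; simpl; field; lra. }
assert (HT : forall T, 0 <= T -> RInt (fun t => Rabs (f2 t)) 0 T <= A).
{ intros T HT; apply improper_int_le_limit; [easy|intros; apply Rabs_pos|easy]. }
exists A; split; [|easy].
specialize (HT 0 (Rle_refl 0)); rewrite RInt_point in HT; apply HT.
Qed.

(** Gauss-Bonnet for a surface of revolution: adding the two parts gives $c = -2\pi\int f'' = 2\pi(1
    - \lim f')$. The limit is positive exactly when $c < 2\pi$. *)
Lemma slope_limit (f f1 f2 : R -> R) (c : R) :
  (forall t, 0 < t -> 0 < f t) -> f1 0 = 1 ->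
  (forall x, is_derive f1 x (f2 x)) -> (forall x, continuous f2 x) ->
  total_curvature f f2 c ->
  forall eps, 0 < eps -> exists T0, 0 <= T0 /\
    forall T, T0 <= T -> Rabs (f1 T - (1 - c / (2 * PI))) < eps.
Proof.
intros Hf H0 Hd Hcont Hc; apply total_curvature_iff in Hc; [|easy].
destruct Hc as [cp [cn [Hp [Hn ->]]]].
pose proof PI_RGT_0 as HPI.
assert (Hl : improper_int f2 (- / (2 * PI) * cp + - / (2 * PI) * cn)).
{ eapply improper_int_ext; [|apply (improper_int_lin _ _ (- / (2 * PI)) (- / (2 * PI)) _ _ Hp Hn)].
  intros; simpl; field; lra. }
apply improper_int_iff in Hl; destruct Hl as [_ Hl].
intros eps Heps; destruct (Hl eps Heps) as [T0 [HT0 H]].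
exists T0; split; [easy|]; intros T HT; specialize (H T HT).
assert (E : is_RInt f2 0 T (f1 T - f1 0)).
{ apply (is_RInt_derive f1 f2); intros; [apply Hd|apply Hcont]. }
rewrite (is_RInt_unique _ _ _ _ E), H0 in H.
replace (f1 T - (1 - (cp + cn) / (2 * PI)))
  with (f1 T - 1 - (- / (2 * PI) * cp + - / (2 * PI) * cn)) by (field; lra).
exact H.
Qed.

(** Beyond some $T$ the slope lies between $a/2$ and $2a$, which gives both linear bounds there; on
    $[1/2,T]$ compactness gives the lower one. The lower bound starts at $1/2$ because a profile
    vanishes at 0, and the spikes are supported where it holds. *)
Lemma linear_growth (f f1 : R -> R) (a : R) : 0 < a ->
  (forall x, is_derive f x (f1 x)) -> (forall t, 0 < t -> 0 < f t) ->
  (forall eps, 0 < eps -> exists T0, 0 <= T0 /\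
    forall T, T0 <= T -> Rabs (f1 T - a) < eps) ->
  (exists beta, 0 < beta /\ forall t, 1 / 2 <= t -> beta * (1 + t) <= f t) /\
  (exists C T1, 0 < C /\ 0 <= T1 /\ forall t, T1 <= t -> f t <= C * (1 + t)).
Proof.
intros Ha Hd Hpos Hlim.
destruct (Hlim (a / 2) ltac:(lra)) as [T0 [HT0 H0]].
set (T := T0 + 1).
assert (H : forall t, T <= t -> a / 2 <= f1 t <= 2 * a).
{ intros t Ht; specialize (H0 t ltac:(unfold T in Ht; lra)).
  apply Rabs_lt_between in H0; lra. }
assert (HT : 1 <= T) by (unfold T; lra).
split.
- destruct (continuity_ab_min (fun t => f t * / (1 + t)) (1 / 2) T) as [x [Hx Hx']].
  + lra.
  + intros t Ht; apply continuity_pt_filterlim.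
    apply (ex_derive_continuous (fun t => f t * / (1 + t))).
    apply (ex_derive_mult f (fun t => / (1 + t))); [now exists (f1 t)|auto_derive; lra].
  + set (b := f x * / (1 + x)) in *.
    assert (Hb : 0 < b).
    { apply Rmult_lt_0_compat; [apply Hpos; lra|apply Rinv_0_lt_compat; lra]. }
    assert (Hle : forall t, 1 / 2 <= t <= T -> b * (1 + t) <= f t).
    { intros t Ht; specialize (Hx t Ht); simpl in Hx.
      apply (Rmult_le_compat_r (1 + t)) in Hx; [|lra].
      rewrite Rmult_assoc, Rinv_l, Rmult_1_r in Hx by lra; exact Hx. }
    assert (Hm : 0 < Rmin b (a / 2)) by (apply Rmin_pos; lra).
    pose proof (Rmin_l b (a / 2)); pose proof (Rmin_r b (a / 2)).
    set (beta := Rmin b (a / 2)) in *.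
    exists beta; split; [easy|]; intros t Ht.
    destruct (Rle_dec t T) as [HtT|HtT].
    * specialize (Hle t ltac:(lra)); nra.
    * assert (Hi : f T - beta * (1 + T) <= f t - beta * (1 + t)).
      { apply (le_of_derive_ge0 (fun x => f x - beta * (1 + x)) (fun x => f1 x - beta)).
        - lra.
        - intros y _; specialize (Hd y).
          replace (f1 y - beta) with (minus (f1 y) beta) by reflexivity.
          apply @is_derive_minus; [easy|auto_derive; [easy|ring]].
        - intros y Hy; specialize (H y ltac:(lra)); lra. }
      specialize (Hle T ltac:(lra)); nra.
- assert (HfT : 0 < f T) by (apply Hpos; lra).
  exists (f T + 2 * a), T; split; [lra|]; split; [lra|]; intros t Ht.
  assert (Hi : 2 * a * T - f T <= 2 * a * t - f t).
  { apply (le_of_derive_ge0 (fun x => 2 * a * x - f x) (fun x => 2 * a - f1 x)).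
    - lra.
    - intros y _; specialize (Hd y).
      replace (2 * a - f1 y) with (minus (2 * a) (f1 y)) by reflexivity.
      apply @is_derive_minus; [auto_derive; [easy|ring]|easy].
    - intros y Hy; specialize (H y ltac:(lra)); lra. }
  nra.
Qed.

(** * Deformation of a model surface *)

Section Deformation.
Variables (f f1 f2 g : R -> R) (beta delta : R).
Hypothesis f_smooth : smooth f.
Hypothesis f_odd : forall t, f (- t) = - f t.
Hypothesis f_pos : forall t, 0 < t -> 0 < f t.
Hypothesis f_derive : forall x, is_derive f x (f1 x).
Hypothesis f1_derive : forall x, is_derive f1 x (f2 x).
Hypothesis f1_0 : f1 0 = 1.
Hypothesis g_smooth : smooth_closure g.
Hypothesis g_ge0 : forall t, 0 <= g t.
Hypothesis g_eq0 : forall t, t <= 1 / 2 -> g t = 0.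
Hypothesis beta_pos : 0 < beta.
Hypothesis f_ge : forall t, 1 / 2 <= t -> beta * (1 + t) <= f t.
Hypothesis g_int : forall T, 0 <= T -> RInt g 0 T <= delta.
Hypothesis delta_small : delta / beta ^ 2 <= 1 / 2.

(* Equal to [f ^ 2] on [1/2, oo), and nowhere zero. *)
Definition fsq (t : R) : R := f t ^ 2 + flat 0 (1 / 2 - t).
Definition fsq1 (t : R) : R := 2 * f t * f1 t - flat 2 (1 / 2 - t).
(** In the notation of the outline, [flux] is $v$, [slope] is $-u'$ and [factor] is $u$. *)
Definition flux (t : R) : R := RInt g 0 t.
Definition slope (t : R) : R := flux t * / fsq t.
Definition slope1 (t : R) : R := (g t * fsq t - flux t * fsq1 t) / fsq t ^ 2.
Definition factor (t : R) : R := 1 - RInt slope 0 t.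
(** The product $u(t)u(-t)$ is even, so the deformed profile is odd on the whole line. For $t > 0$
    the reflected factor is 1 and the profile is $f u$. *)
Definition deformed (t : R) : R := f t * (factor t * factor (- t)).
Definition deformed1 (t : R) : R :=
  f1 t * (factor t * factor (- t)) +
  f t * (factor t * slope (- t) - slope t * factor (- t)).
Definition deformed2 (t : R) : R :=
  f2 t * (factor t * factor (- t)) +
  2 * f1 t * (factor t * slope (- t) - slope t * factor (- t)) -
  f t * (slope1 t * factor (- t) + 2 * slope t * slope (- t) +
         factor t * slope1 (- t)).

(** * Smoothness and derivatives of the deformed profile *)

Lemma g_continuous x : continuous g x.
Proof. now apply smooth_closure_continuous. Qed.

(** Away from 0 the square of $f$ is positive by oddness; at 0, where $f$ vanishes, the flat term
    contributes $e^{-2}$. *)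
Lemma fsq_pos t : 0 < fsq t.
Proof.
unfold fsq; pose proof (flat_ge0 0 (1 / 2 - t)); pose proof (pow2_ge_0 (f t)).
destruct (Req_dec t 0) as [->|Ht].
- assert (0 < flat 0 (1 / 2 - 0)); [|lra].
  eapply Rlt_le_trans; [apply (exp_pos (- 2))|apply flat0_ge; lra].
- assert (0 < f t ^ 2); [|lra].
  apply pow2_gt_0; destruct (Rtotal_order t 0) as [H1|[H1|H1]]; [|lra|].
  + specialize (f_pos (- t) ltac:(lra)); rewrite f_odd in f_pos; lra.
  + specialize (f_pos t ltac:(lra)); lra.
Qed.

Lemma fsq_derive t : is_derive fsq t (fsq1 t).
Proof.
unfold fsq, fsq1.
apply (is_derive_plus (fun t => f t ^ 2) (fun t => flat 0 (1 / 2 - t)) t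
         (2 * f t * f1 t) (- flat 2 (1 / 2 - t))).
- replace (2 * f t * f1 t) with (INR 2 * f1 t * f t ^ 1) by (simpl; ring).
  apply (is_derive_pow f 2), f_derive.
- replace (- flat 2 (1 / 2 - t))
    with (-1 * (flat 2 (1 / 2 - t) + - INR 0 * flat 1 (1 / 2 - t))) by (simpl; ring).
  apply (is_derive_comp (flat 0) (fun t => 1 / 2 - t)).
  + apply (flat_derive 0).
  + auto_derive; [easy|ring].
Qed.

Lemma flux_derive t : is_derive flux t (g t).
Proof. exact (is_derive_primitive g t g_continuous). Qed.

Lemma slope_derive t : is_derive slope t (slope1 t).
Proof.
apply (is_derive_div flux fsq); [apply flux_derive|apply fsq_derive|].
pose proof (fsq_pos t); lra.
Qed.

Lemma flux_smooth : smooth_closure flux.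
Proof. apply sc_prim with g; [apply flux_derive|easy]. Qed.

Lemma slope_smooth : smooth_closure slope.
Proof.
apply sc_mult; [apply flux_smooth|apply sc_inv].
- apply sc_plus; [now apply smooth_closure_pow, sc_smooth|].
  apply (sc_comp (flat 0) (fun x => 1 / 2 - x)); [apply sc_flat|].
  replace (fun x => 1 / 2 - x) with (fun x => -1 * x + 1 / 2).
  + apply smooth_closure_affine.
  + apply functional_extensionality; intros; ring.
- intros x; pose proof (fsq_pos x); lra.
Qed.

Lemma factor_derive t : is_derive factor t (- slope t).
Proof.
unfold factor; replace (- slope t) with (minus 0 (slope t))
  by (unfold minus, plus, opp; simpl; ring).
apply (is_derive_minus (fun _ => 1) (RInt slope 0)); [apply @is_derive_const|].
apply is_derive_primitive; intros; apply smooth_closure_continuous, slope_smooth.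
Qed.

Lemma factor_smooth : smooth_closure factor.
Proof.
apply sc_prim with (fun x => - slope x); [apply factor_derive|].
replace (fun x => - slope x) with (fun x => -1 * slope x).
- apply sc_mult; [apply sc_smooth, smooth_const|apply slope_smooth].
- apply functional_extensionality; intros; ring.
Qed.

Lemma is_derive_reflect (h h' : R -> R) t : (forall x, is_derive h x (h' x)) ->
  is_derive (fun x => h (- x)) t (- h' (- t)).
Proof.
intros Hh; replace (- h' (- t)) with (-1 * h' (- t)) by ring.
apply (is_derive_comp h (fun x => - x)); [apply Hh|auto_derive; [easy|ring]].
Qed.

Lemma is_derive_Rmult (a b : R -> R) (x a' b' : R) :
  is_derive a x a' -> is_derive b x b' ->
  is_derive (fun t => a t * b t) x (a' * b x + a x * b').
Proof. intros; apply (is_derive_mult a b); [easy|easy|intros; apply Rmult_comm]. Qed.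

Lemma deformed_derive t : is_derive deformed t (deformed1 t).
Proof.
pose proof (is_derive_reflect factor _ t factor_derive) as Hr.
replace (deformed1 t) with
  (f1 t * (factor t * factor (- t)) +
   f t * (- slope t * factor (- t) + factor t * - - slope (- t)))
  by (unfold deformed1; ring).
apply (is_derive_Rmult f (fun x => factor x * factor (- x))); [apply f_derive|].
now apply (is_derive_Rmult factor (fun x => factor (- x))); [apply factor_derive|].
Qed.

Lemma deformed1_derive t : is_derive deformed1 t (deformed2 t).
Proof.
pose proof (is_derive_reflect factor _ t factor_derive) as Hr.
pose proof (is_derive_reflect slope _ t slope_derive) as Hs.
replace (deformed2 t) with
  ((f2 t * (factor t * factor (- t)) +
    f1 t * (- slope t * factor (- t) + factor t * - - slope (- t))) +
   (f1 t * (factor t * slope (- t) - slope t * factor (- t)) +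
    f t * ((- slope t * slope (- t) + factor t * - slope1 (- t)) -
           (slope1 t * factor (- t) + slope t * - - slope (- t)))))
  by (unfold deformed2; ring).
apply (is_derive_plus (fun x => f1 x * (factor x * factor (- x)))
  (fun x => f x * (factor x * slope (- x) - slope x * factor (- x)))).
- apply (is_derive_Rmult f1 (fun x => factor x * factor (- x))); [apply f1_derive|].
  now apply (is_derive_Rmult factor (fun x => factor (- x))); [apply factor_derive|].
- apply (is_derive_Rmult f (fun x => factor x * slope (- x) - slope x * factor (- x)));
    [apply f_derive|].
  apply (is_derive_minus (fun x => factor x * slope (- x))
    (fun x => slope x * factor (- x))).
  + now apply (is_derive_Rmult factor (fun x => slope (- x))); [apply factor_derive|].
  + now apply (is_derive_Rmult slope (fun x => factor (- x))); [apply slope_derive|].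
Qed.

(** * Estimates for the flux and the factor *)

Lemma flux_bounds t : 0 <= t -> 0 <= flux t <= delta.
Proof.
intros Ht; split; [|now apply g_int].
apply RInt_ge_0; [easy|apply ex_RInt_of_continuous, g_continuous|easy].
Qed.

Lemma flux_eq0 t : t <= 1 / 2 -> flux t = 0.
Proof.
intros Ht; apply RInt_eq0; intros x Hx; apply g_eq0.
assert (Rmax 0 t <= 1 / 2) by (apply Rmax_lub; lra); lra.
Qed.

Lemma slope_eq0 t : t <= 1 / 2 -> slope t = 0.
Proof. intros Ht; unfold slope; rewrite flux_eq0; lra. Qed.

Lemma slope1_eq0 t : t <= 1 / 2 -> slope1 t = 0.
Proof.
intros Ht; unfold slope1; rewrite flux_eq0, g_eq0 by easy.
unfold Rdiv; ring.
Qed.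

Lemma factor_eq1 t : t <= 1 / 2 -> factor t = 1.
Proof.
intros Ht; unfold factor; rewrite RInt_eq0; [ring|].
intros x Hx; apply slope_eq0.
assert (Rmax 0 t <= 1 / 2) by (apply Rmax_lub; lra); lra.
Qed.

(** The flux is at most [delta] and vanishes up to $1/2$; beyond that $f^2 \ge \beta^2(1+t)^2$. This
    decay is integrable with total mass $\delta/\beta^2$, which gives [factor_bounds]. *)
Lemma slope_bounds t : 0 <= t -> 0 <= slope t <= delta / beta ^ 2 * / (1 + t) ^ 2.
Proof.
intros Ht; pose proof (flux_bounds t Ht) as Hv.
assert (Hb : 0 < beta ^ 2) by now apply pow_lt.
assert (Ht2 : 0 < (1 + t) ^ 2) by (apply pow_lt; lra).
pose proof (Rinv_0_lt_compat _ (fsq_pos t)) as Hi.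
split; [unfold slope; nra|].
destruct (Rle_dec t (1 / 2)) as [H|H].
- rewrite slope_eq0 by easy; apply Rmult_le_pos.
  + apply Rmult_le_pos; [lra|apply Rlt_le, Rinv_0_lt_compat, Hb].
  + apply Rlt_le, Rinv_0_lt_compat, Ht2.
- unfold slope; replace (delta / beta ^ 2 * / (1 + t) ^ 2)
    with (delta * / (beta * (1 + t)) ^ 2) by (field; lra).
  apply Rmult_le_compat; [lra|lra|lra|].
  assert (0 < beta * (1 + t)) by nra.
  apply Rinv_le_contravar; [now apply pow_lt|].
  unfold fsq; rewrite flat_nonpos, Rplus_0_r by lra.
  apply pow_incr; split; [lra|apply f_ge; lra].
Qed.

Lemma factor_bounds t : 0 <= t -> 1 - delta / beta ^ 2 <= factor t <= 1.
Proof.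
intros Ht; unfold factor.
assert (Hi : ex_RInt slope 0 t).
{ apply ex_RInt_of_continuous; intros; apply smooth_closure_continuous, slope_smooth. }
assert (H0 : 0 <= RInt slope 0 t).
{ apply RInt_ge_0; [easy|easy|intros x Hx; apply slope_bounds; lra]. }
assert (Hd : 0 <= delta / beta ^ 2).
{ apply Rmult_le_pos; [|apply Rlt_le, Rinv_0_lt_compat; now apply pow_lt].
  pose proof (flux_bounds 0 (Rle_refl 0)); lra. }
set (c := delta / beta ^ 2) in *.
assert (H1 : RInt slope 0 t <= - c * / (1 + t) - - c * / (1 + 0)).
{ apply (RInt_le_of_derive_ge slope (fun x => - c * / (1 + x))
           (fun x => c * / (1 + x) ^ 2)); [easy|easy| | |].
  - intros x Hx; auto_derive; [lra|field; lra].
  - intros x Hx; apply @ex_derive_continuous; auto_derive.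
    apply Rgt_not_eq; nra.
  - intros x Hx; apply slope_bounds; lra. }
assert (0 < / (1 + t)) by (apply Rinv_0_lt_compat; lra).
rewrite Rplus_0_r, Rinv_1 in H1; nra.
Qed.

Lemma factor_half t : 0 <= t -> 1 / 2 <= factor t.
Proof. intros Ht; pose proof (factor_bounds t Ht); lra. Qed.

Lemma deformed_pos_eq t : 0 < t -> deformed t = f t * factor t.
Proof. intros Ht; unfold deformed; rewrite (factor_eq1 (- t)) by lra; ring. Qed.

(* The flux satisfies [(f ^ 2 * factor')' = - g], which is what cancels the
   first-order terms. *)
Lemma deformed2_pos_eq t : 0 < t -> deformed2 t = f2 t * factor t - g t / f t.
Proof.
intros Ht; unfold deformed2.
rewrite (factor_eq1 (- t)), (slope_eq0 (- t)), (slope1_eq0 (- t)) by lra.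
pose proof (f_pos t Ht).
destruct (Rle_dec t (1 / 2)) as [H1|H1].
- rewrite slope_eq0, slope1_eq0, g_eq0 by easy; field; lra.
- unfold slope1, slope.
  replace (fsq1 t) with (2 * f t * f1 t)
    by (unfold fsq1; rewrite flat_nonpos by lra; ring).
  replace (fsq t) with (f t ^ 2)
    by (unfold fsq; rewrite flat_nonpos by lra; ring).
  field; lra.
Qed.

(** * The deformed surface and its curvature *)

Lemma deformed_model_surface : model_surface deformed.
Proof.
split; [|split; [|split]].
- apply smooth_closure_smooth.
  apply sc_mult; [now apply sc_smooth|].
  apply sc_mult; [apply factor_smooth|apply (sc_comp factor); [apply factor_smooth|]].
  replace Ropp with (fun x => -1 * x + 0).
  + apply smooth_closure_affine.
  + apply functional_extensionality; intros; ring.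
- intros t; unfold deformed; rewrite f_odd, Ropp_involutive; ring.
- apply is_derive_Reals; replace 1 with (deformed1 0); [apply deformed_derive|].
  unfold deformed1; rewrite Ropp_0, factor_eq1, f1_0, slope_eq0 by lra; ring.
- intros t Ht; rewrite deformed_pos_eq by easy.
  pose proof (f_pos t Ht); pose proof (factor_half t (Rlt_le _ _ Ht)); nra.
Qed.

Lemma deformed_second_deriv : second_deriv deformed deformed2.
Proof.
exists deformed1; split; intros t; apply is_derive_Reals.
- apply deformed_derive.
- apply deformed1_derive.
Qed.

Lemma deformed_radial_curv t : 0 < t ->
  radial_curv deformed deformed2 t =
  radial_curv f f2 t + g t / (f t ^ 2 * factor t).
Proof.
intros Ht; unfold radial_curv.
rewrite deformed_pos_eq, deformed2_pos_eq by easy.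
pose proof (f_pos t Ht); pose proof (factor_half t (Rlt_le _ _ Ht)).
field; lra.
Qed.

Lemma deformed_radial_curv_ge t : 0 <= t ->
  radial_curv deformed deformed2 t >= radial_curv f f2 t.
Proof.
intros [Ht|<-].
- rewrite deformed_radial_curv by easy.
  pose proof (f_pos t Ht); pose proof (factor_half t (Rlt_le _ _ Ht)).
  assert (0 <= g t / (f t ^ 2 * factor t)); [|lra].
  apply Rmult_le_pos; [apply g_ge0|apply Rlt_le, Rinv_0_lt_compat].
  apply Rmult_lt_0_compat; [now apply pow_lt|lra].
(* At the origin both profiles vanish, and division by zero returns 0, so both curvatures take the
   formal value 0. *)
- assert (H0 : f 0 = 0) by (pose proof (f_odd 0) as H; rewrite Ropp_0 in H; lra).
  unfold radial_curv, deformed; rewrite H0, Rmult_0_l.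
  unfold Rdiv; rewrite Rinv_0, !Rmult_0_r; lra.
Qed.

Lemma g_div_f_le t : 0 < t -> 0 <= g t / f t <= g t / beta.
Proof.
intros Ht; pose proof (f_pos t Ht) as Hf; split.
- apply Rmult_le_pos; [apply g_ge0|apply Rlt_le, Rinv_0_lt_compat, Hf].
- destruct (Rle_dec t (1 / 2)) as [H|H].
  + rewrite g_eq0 by easy; unfold Rdiv; rewrite !Rmult_0_l; lra.
  + apply Rmult_le_compat_l; [apply g_ge0|apply Rinv_le_contravar; [easy|]].
    pose proof (f_ge t ltac:(lra)); nra.
Qed.

(** Here $m'' - f'' = -f''(1-u) - g/f$ with $0 \le 1-u \le \delta/\beta^2$. Both terms on the right
    have integral of order [delta], since $\int|f''|$ is finite. *)
Lemma second_deriv_diff t : 0 < t ->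
  Rabs (deformed2 t - f2 t) <= delta / beta ^ 2 * Rabs (f2 t) + g t / beta.
Proof.
intros Ht; rewrite deformed2_pos_eq by easy.
replace (_ - _) with (- (f2 t * (1 - factor t)) + - (g t / f t)) by ring.
eapply Rle_trans; [apply Rabs_triang|]; rewrite !Rabs_Ropp, Rabs_mult.
pose proof (factor_bounds t (Rlt_le _ _ Ht)); pose proof (g_div_f_le t Ht).
rewrite (Rabs_right (1 - factor t)), (Rabs_right (g t / f t)) by lra.
pose proof (Rabs_pos (f2 t)); nra.
Qed.

Lemma f2_continuous x : continuous f2 x.
Proof.
apply smooth_closure_continuous, sc_smooth.
now apply (smooth_second_deriv f f1).
Qed.

Lemma deformed2_continuous x : continuous deformed2 x.
Proof.
apply smooth_closure_continuous, sc_smooth.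
apply (smooth_second_deriv deformed deformed1).
- apply deformed_model_surface.
- apply deformed_derive.
- apply deformed1_derive.
Qed.

(** The values $s = \pi$ and $s = -\pi$ treat the positive and the negative part at once. As the
    absolute value is 1-Lipschitz, the integrands differ by at most $2\pi|m'' - f''|$, and
    domination gives convergence together with the bound. *)
Lemma deformed_curvature_part (s A l : R) : Rabs s = PI ->
  (forall T, 0 <= T -> RInt (fun t => Rabs (f2 t)) 0 T <= A) ->
  improper_int (fun t => - PI * f2 t + s * Rabs (f2 t)) l ->
  exists l', improper_int (fun t => - PI * deformed2 t + s * Rabs (deformed2 t)) l' /\
    Rabs (l - l') <= 2 * PI * (delta / beta ^ 2 * A + delta / beta).
Proof.
intros Hs HA Hl; pose proof PI_RGT_0 as HPI.
set (c := delta / beta ^ 2).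
assert (Hc : 0 <= c).
{ pose proof (factor_bounds 0 (Rle_refl 0)); unfold c; lra. }
assert (Hint : forall T, 0 <= T ->
  is_RInt (fun t => 2 * PI * (c * Rabs (f2 t) + / beta * g t)) 0 T
    (2 * PI * (c * RInt (fun t => Rabs (f2 t)) 0 T + / beta * RInt g 0 T))).
{ intros T HT.
  apply (is_RInt_scal (fun t => c * Rabs (f2 t) + / beta * g t)).
  apply (is_RInt_plus (fun t => c * Rabs (f2 t)) (fun t => / beta * g t)).
  - apply (is_RInt_scal (fun t => Rabs (f2 t))), @RInt_correct, ex_RInt_of_continuous.
    intros x; apply (continuous_comp f2 Rabs); [apply f2_continuous|apply continuous_Rabs].
  - apply (is_RInt_scal g), @RInt_correct, ex_RInt_of_continuous, g_continuous. }
destruct (improper_int_dominated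
  (fun t => (- PI * deformed2 t + s * Rabs (deformed2 t)) -
            (- PI * f2 t + s * Rabs (f2 t)))
  (fun t => 2 * PI * (c * Rabs (f2 t) + / beta * g t))
  (2 * PI * (c * A + delta / beta))) as [d [Hd Hdb]].
- intros T HT; apply ex_RInt_of_continuous; intros x.
  apply (continuous_minus (fun t => - PI * deformed2 t + s * Rabs (deformed2 t))
           (fun t => - PI * f2 t + s * Rabs (f2 t))); apply continuous_lin_abs.
  + apply deformed2_continuous.
  + apply f2_continuous.
- intros T HT; eexists; now apply Hint.
- intros t Ht; pose proof (second_deriv_diff t Ht) as H; fold c in H.
  replace (_ - _) with
    (- PI * (deformed2 t - f2 t) + s * (Rabs (deformed2 t) - Rabs (f2 t))) by ring.
  eapply Rle_trans; [apply Rabs_triang|]; rewrite !Rabs_mult, Rabs_Ropp, Hs.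
  rewrite (Rabs_right PI) by lra.
  pose proof (Rabs_triang_inv2 (deformed2 t) (f2 t)); unfold Rdiv in H; nra.
- intros T HT; rewrite (is_RInt_unique _ _ _ _ (Hint T HT)).
  specialize (HA T HT); specialize (g_int T HT).
  pose proof (Rinv_0_lt_compat _ beta_pos); unfold Rdiv.
  apply Rmult_le_compat_l; [lra|]; nra.
- exists (1 * l + 1 * d); split.
  + eapply improper_int_ext; [|apply (improper_int_lin _ _ 1 1 _ _ Hl Hd)].
    intros; simpl; ring.
  + replace (l - _) with (- d) by ring; now rewrite Rabs_Ropp.
Qed.

Lemma deformed_total_curvature (A c : R) :
  (forall T, 0 <= T -> RInt (fun t => Rabs (f2 t)) 0 T <= A) ->
  total_curvature f f2 c ->
  exists c', total_curvature deformed deformed2 c' /\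
    Rabs (c - c') <= 4 * PI * (delta / beta ^ 2 * A + delta / beta).
Proof.
intros HA Hc; apply total_curvature_iff in Hc; [|easy].
destruct Hc as [cp [cn [Hp [Hn ->]]]]; pose proof PI_RGT_0 as HPI.
destruct (deformed_curvature_part PI A cp) as [cp' [Hp' Hdp]]; [apply Rabs_right; lra|easy|easy|].
destruct (deformed_curvature_part (- PI) A cn) as [cn' [Hn' Hdn]];
  [rewrite Rabs_Ropp; apply Rabs_right; lra|easy|easy|].
exists (cp' + cn'); split.
- apply total_curvature_iff; [apply deformed_model_surface|now exists cp', cn'].
- replace (_ - _) with ((cp - cp') + (cn - cn')) by ring.
  eapply Rle_trans; [apply Rabs_triang|]; lra.
Qed.

(** From $f^2 \ge \beta^2$ on the support of $g$ and $u \ge 1/2$ follows $h^2 \le 4g^2/\beta^4$, and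
    $g^2 \le wg$ reduces the $L^2$ bound to the weighted integral of $g$. *)
Lemma deformed_L2 (w : R -> R) (M : R) :
  (forall t, 0 <= t -> g t <= w t) -> (forall x, continuous w x) ->
  (forall T, 0 <= T -> RInt (fun t => w t * g t) 0 T <= M) ->
  exists l, improper_int
      (fun t => (radial_curv deformed deformed2 t - radial_curv f f2 t) ^ 2) l /\
    0 <= l <= 4 / beta ^ 4 * M.
Proof.
intros Hw Hwc HM.
assert (Hb4 : 0 < / beta ^ 4) by now apply Rinv_0_lt_compat, pow_lt.
(* Using [fsq] in place of $f^2$ changes nothing for $t > 0$, since $g$ vanishes where they differ,
   and makes $h$ continuous at 0. *)
pose (h := fun t => g t * / (fsq t * factor t)).
assert (Hh : forall t, 0 < t ->
  radial_curv deformed deformed2 t - radial_curv f f2 t = h t).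
{ intros t Ht; rewrite deformed_radial_curv by easy; unfold h, Rdiv.
  destruct (Rle_dec t (1 / 2)) as [H|H]; [rewrite g_eq0 by easy; ring|].
  unfold fsq; rewrite flat_nonpos, Rplus_0_r by lra; ring. }
assert (Hhc : forall t, 0 <= t -> continuous (fun t => h t ^ 2) t).
{ intros t Ht; apply (continuous_comp h (fun y => y ^ 2)).
  - apply (continuous_mult g (fun t => / (fsq t * factor t))); [apply g_continuous|].
    apply continuous_Rinv_comp.
    + apply (continuous_mult fsq factor); [|apply smooth_closure_continuous, factor_smooth].
      apply @ex_derive_continuous; exists (fsq1 t); apply fsq_derive.
    + pose proof (fsq_pos t); pose proof (factor_half t Ht); nra.
  - apply @ex_derive_continuous; auto_derive; easy. }
assert (Hhi : forall T, 0 <= T -> ex_RInt (fun t => h t ^ 2) 0 T).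
{ intros T HT; apply @ex_RInt_continuous; intros z Hz; apply Hhc.
  rewrite Rmin_left in Hz by easy; lra. }
assert (Hwi : forall T, ex_RInt (fun t => w t * g t) 0 T).
{ intros T; apply ex_RInt_of_continuous; intros x.
  apply (continuous_mult w g); [apply Hwc|apply g_continuous]. }
assert (Hle : forall t, 0 < t -> h t ^ 2 <= 4 / beta ^ 4 * (w t * g t)).
{ intros t Ht; pose proof (g_ge0 t) as Hg; pose proof (Hw t ltac:(lra)).
  assert (0 <= w t * g t - g t ^ 2) by nra.
  apply Rle_trans with (4 / beta ^ 4 * g t ^ 2); [|unfold Rdiv; nra].
  destruct (Rle_dec t (1 / 2)) as [H1|H1].
  { unfold h; rewrite g_eq0 by easy; unfold Rdiv; lra. }
  replace (4 / beta ^ 4 * g t ^ 2) with ((g t * / (beta ^ 2 * (1 / 2))) ^ 2)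
    by (field; lra).
  assert (Hb2 : 0 < beta ^ 2) by now apply pow_lt.
  assert (Hf : beta ^ 2 <= fsq t).
  { unfold fsq; rewrite flat_nonpos, Rplus_0_r by lra.
    pose proof (f_ge t ltac:(lra)); apply pow_incr; nra. }
  pose proof (factor_half t ltac:(lra)).
  apply pow_incr; unfold h; split.
  - apply Rmult_le_pos; [easy|apply Rlt_le, Rinv_0_lt_compat; nra].
  - apply Rmult_le_compat_l; [easy|apply Rinv_le_contravar; nra]. }
destruct (improper_int_of_bounded (fun t => h t ^ 2) (4 / beta ^ 4 * M)) as [l [Hl Hlb]].
- easy.
- intros; apply pow2_ge_0.
- intros T HT; apply Rle_trans with (4 / beta ^ 4 * RInt (fun t => w t * g t) 0 T).
  + rewrite <- (RInt_scal (fun t => w t * g t)) by apply Hwi.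
    apply RInt_le; [easy|now apply Hhi|now apply @ex_RInt_scal|].
    intros x Hx; apply Hle; lra.
  + apply Rmult_le_compat_l; [unfold Rdiv; lra|now apply HM].
- exists l; split; [|split; [|easy]].
  + revert Hl; apply improper_int_ext; intros t Ht; now rewrite Hh.
  + pose proof (improper_int_le_limit _ l 0 (Rle_refl 0) (fun t _ => pow2_ge_0 (h t)) Hl) as H.
    rewrite RInt_point in H; apply H.
Qed.

(** After multiplication by $f^2$, the terms $|f''|f$ and $Bf^2$ are of order $Y^2$ at a large
    integer, while $g$ is at least $kY^3$ there. *)
Lemma deformed_radial_curv_unbounded (Y : R -> R) (k c C T1 : R) :
  0 < k -> 0 < c -> 0 < C -> 0 <= T1 ->
  (forall t, 0 <= t -> 1 + t <= Y t) ->
  (forall n, (1 <= n)%nat -> k * Y (INR n) ^ 3 <= g (INR n)) ->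
  (forall t, 0 <= t -> Rabs (f2 t) <= c * Y t) ->
  (forall t, T1 <= t -> f t <= C * (1 + t)) ->
  forall B T, exists t, T < t /\ B < radial_curv deformed deformed2 t.
Proof.
intros Hk Hc HC HT1 HY Hg Hf2 Hf B T.
(* Once $Y \ge X$, the cubic term beats the two quadratic ones; the summand 1 makes the inequality
   strict. *)
set (X := (c * C + Rabs B * C ^ 2 + 1) / k).
assert (HB := Rabs_pos B).
assert (HC2 : 0 < C ^ 2) by now apply pow_lt.
assert (HX : 0 < X) by (apply Rdiv_lt_0_compat; [nra|easy]).
destruct (INR_unbounded (Rabs T + T1 + X)) as [n Hn].
pose proof (Rle_abs T); pose proof (Rabs_pos T).
assert (Hn0 : 0 < INR n) by lra.
assert (Hn1 : (1 <= n)%nat) by (apply (INR_lt 0), Hn0).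
exists (INR n); split; [lra|].
specialize (Hg n Hn1); specialize (HY (INR n) ltac:(lra)).
specialize (Hf2 (INR n) ltac:(lra)); specialize (Hf (INR n) ltac:(lra)).
rewrite deformed_radial_curv by easy; unfold radial_curv.
pose proof (f_pos _ Hn0) as Hp.
pose proof (factor_bounds (INR n) ltac:(lra)) as Hu.
pose proof (factor_half (INR n) ltac:(lra)) as Hu'.
pose proof (g_ge0 (INR n)) as Hg0.
set (t := INR n) in *; set (y := Y t) in *; set (z := f t) in *.
assert (Hz2 : 0 < z ^ 2) by now apply pow_lt.
(* Since $0 < u \le 1$, replacing $f^2u$ by $f^2$ only lowers the curvature. *)
apply Rlt_le_trans with (- f2 t / z + g t / z ^ 2).
- assert (Hy : c * C + Rabs B * C ^ 2 + 1 <= k * y).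
  { replace (c * C + Rabs B * C ^ 2 + 1) with (k * X) by (unfold X; field; lra).
    apply Rmult_le_compat_l; lra. }
  assert (Hy2 : 0 < y ^ 2) by (apply pow_lt; lra).
  assert (Hzy : z <= C * y) by nra.
  assert (H1 : Rabs (f2 t) * z <= c * C * y ^ 2).
  { replace (c * C * y ^ 2) with (c * y * (C * y)) by ring.
    apply Rmult_le_compat; [apply Rabs_pos|lra|easy|easy]. }
  assert (H2 : B * z ^ 2 <= Rabs B * C ^ 2 * y ^ 2).
  { replace (Rabs B * C ^ 2 * y ^ 2) with (Rabs B * (C * y) ^ 2) by ring.
    apply Rle_trans with (Rabs B * z ^ 2).
    - apply Rmult_le_compat_r; [lra|apply Rle_abs].
    - apply Rmult_le_compat_l; [easy|apply pow_incr; lra]. }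
  assert (H3 : (c * C + Rabs B * C ^ 2 + 1) * y ^ 2 <= k * y ^ 3).
  { replace (k * y ^ 3) with (k * y * y ^ 2) by ring.
    apply Rmult_le_compat_r; lra. }
  assert (H4 : f2 t * z <= Rabs (f2 t) * z).
  { apply Rmult_le_compat_r; [lra|apply Rle_abs]. }
  replace (- f2 t / z + g t / z ^ 2) with ((- (f2 t * z) + g t) / z ^ 2) by (field; lra).
  apply Rlt_div_r; [easy|]; lra.
- apply Rplus_le_compat_l, Rmult_le_compat_l; [easy|].
  apply Rinv_le_contravar; nra.
Qed.

End Deformation.

(** * The deformed surface with spikes *)

(** Take $Y = 1 + \int_0^t (1 + h'^2)$. Because $1 + h'^2 \ge |h'|$, both $Y - h$ and $Y + h$ are
    nondecreasing, so $|h| \le Y - 1 + |h(0)|$ for $t \ge 0$; the square avoids the nonsmooth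
    $|h'|$. *)
Lemma smooth_monotone_majorant (h : R -> R) : smooth h ->
  exists (Y : R -> R) (c : R), 0 < c /\ smooth_closure Y /\
    (forall s t, 0 <= s <= t -> Y s <= Y t) /\
    (forall t, 0 <= t -> 1 + t <= Y t) /\
    (forall t, 0 <= t -> Rabs (h t) <= c * Y t).
Proof.
intros Hh; destruct (smooth_closure_derive h (sc_smooth h Hh)) as [h' [Hd Sh']].
pose (y := fun t => 1 + h' t ^ 2).
assert (Sy : smooth_closure y).
{ apply sc_plus; [apply sc_smooth, smooth_const|now apply smooth_closure_pow]. }
pose (Y := fun t => 1 + RInt y 0 t).
assert (HY0 : Y 0 = 1).
{ unfold Y; rewrite RInt_point; unfold zero; simpl; ring. }
assert (HdY : forall t, is_derive Y t (y t)).
{ intros t; unfold Y; rewrite <- (Rplus_0_l (y t)).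
  apply (is_derive_plus (fun _ => 1) (RInt y 0)); [apply @is_derive_const|].
  apply is_derive_primitive; intros; now apply smooth_closure_continuous. }
assert (Hlin : forall t, 0 <= t -> 1 + t <= Y t).
{ intros t Ht; pose proof (le_of_derive_ge0 (fun x => Y x - x) (fun x => y x - 1) 0 t Ht) as H.
  simpl in H; rewrite HY0 in H; assert (1 - 0 <= Y t - t); [|lra].
  apply H; intros x _.
  - apply (is_derive_minus Y (fun x => x)); [apply HdY|apply @is_derive_id].
  - unfold y; pose proof (pow2_ge_0 (h' x)); lra. }
exists Y, (Rabs (h 0) + 1); split; [pose proof (Rabs_pos (h 0)); lra|].
split; [now apply sc_prim with y|split; [|split; [easy|]]].
- intros s t Hst; apply le_of_derive_ge0 with y; [lra|intros; apply HdY|].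
  intros x _; unfold y; pose proof (pow2_ge_0 (h' x)); lra.
- intros t Ht.
  assert (H1 : Y 0 - h 0 <= Y t - h t).
  { apply (le_of_derive_ge0 (fun x => Y x - h x) (fun x => y x - h' x)); [easy| |].
    - intros x _; now apply (is_derive_minus Y h).
    - intros x _; unfold y; nra. }
  assert (H2 : Y 0 + h 0 <= Y t + h t).
  { apply (le_of_derive_ge0 (fun x => Y x + h x) (fun x => y x + h' x)); [easy| |].
    - intros x _; now apply (is_derive_plus Y h).
    - intros x _; unfold y; nra. }
  rewrite HY0 in H1, H2; pose proof (Rabs_pos (h 0)).
  specialize (Hlin t Ht).
  assert (Ha := Rle_abs (h 0)); assert (Hb := Rle_abs (- h 0)).
  rewrite Rabs_Ropp in Hb; apply Rabs_le_between; nra.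
Qed.

Theorem theorem3p1 (f f2 : R -> R) (cM : R) :
  model_surface f -> second_deriv f f2 ->
  total_curvature f f2 cM -> cM < 2 * PI ->
  forall eps : R, 0 < eps ->
  exists (m m2 : R -> R) (cMeps : R),
    model_surface m /\ second_deriv m m2 /\
    total_curvature m m2 cMeps /\
    (forall t : R, 0 <= t -> radial_curv m m2 t >= radial_curv f f2 t) /\
    (exists l : R,
       improper_int (fun t => (radial_curv m m2 t - radial_curv f f2 t) ^ 2) l /\
       sqrt l < eps) /\
    (forall (B T : R), exists t : R, T < t /\ B < radial_curv m m2 t) /\
    Rabs (cM - cMeps) < eps.
Proof.
intros [Sf [Hodd [Hf0 Hpos]]] [f1 [Hf1 Hf2]] Hc HcM eps Heps.
assert (Hd1 : forall x, is_derive f x (f1 x)) by (intros; apply is_derive_Reals, Hf1).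
assert (Hd2 : forall x, is_derive f1 x (f2 x)) by (intros; apply is_derive_Reals, Hf2).
assert (H01 : f1 0 = 1) by (apply (uniqueness_limite f 0); [apply Hf1|exact Hf0]).
assert (Sf2 : smooth f2) by now apply (smooth_second_deriv f f1).
assert (HPI := PI_RGT_0).
destruct (RInt_abs_second_deriv_bounded f f2 cM Hpos Hc) as [A [HA0 HA]].
destruct (linear_growth f f1 (1 - cM / (2 * PI))) as [[beta [Hb Hfb]] [C [T1 [HC [HT1 HfC]]]]].
{ assert (cM / (2 * PI) < 1); [apply Rlt_div_l; lra|lra]. }
{ exact Hd1. }
{ exact Hpos. }
{ apply (slope_limit f f1 f2); try easy.
  intros; now apply smooth_closure_continuous, sc_smooth. }
destruct (smooth_monotone_majorant f2 Sf2) as [Y [c [Hc0 [SY [Ymono [Yge Yf2]]]]]].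
assert (Hb2 : 0 < / beta ^ 2) by now apply Rinv_0_lt_compat, pow_lt.
assert (Hb4 : 0 < / beta ^ 4) by now apply Rinv_0_lt_compat, pow_lt.
assert (Hb1 : 0 < / beta) by now apply Rinv_0_lt_compat.
(* The conditions $\delta X_i < 1$ express the three smallness requirements in turn: $\delta/\beta^2
   \le 1/2$, the squared $L^2$ bound below $\varepsilon^2$, and the change of total curvature below
   $\varepsilon$. *)
set (X1 := 2 * / beta ^ 2).
set (X2 := 4 * / beta ^ 4 / eps ^ 2).
set (X3 := 4 * PI * (/ beta ^ 2 * A + / beta) / eps).
assert (He2 : 0 < eps ^ 2) by now apply pow_lt.
assert (HX1 : 0 < X1) by (unfold X1; lra).
assert (HX2 : 0 < X2) by (apply Rdiv_lt_0_compat; lra).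
assert (HX3 : 0 < X3).
{ apply Rdiv_lt_0_compat; [apply Rmult_lt_0_compat; [lra|nra]|easy]. }
(* With this choice $\delta$ and the three products $\delta X_i$ are positive with sum 1, so each
   product is less than 1. *)
set (delta := / (1 + X1 + X2 + X3)).
assert (Hdelta : 0 < delta) by (apply Rinv_0_lt_compat; lra).
assert (Hsum : delta + delta * X1 + delta * X2 + delta * X3 = 1).
{ unfold delta; field; lra. }
assert (HD1 : 0 < delta * X1) by now apply Rmult_lt_0_compat.
assert (HD2 : 0 < delta * X2) by now apply Rmult_lt_0_compat.
assert (HD3 : 0 < delta * X3) by now apply Rmult_lt_0_compat.
(* The sharpness $\mu = 4/\delta$ turns the bound $4/\mu$ on the weighted integral into $\delta$. *)
set (g := spikes Y (4 / delta)).
assert (Hmu : 0 < 4 / delta) by (apply Rdiv_lt_0_compat; lra).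
assert (Sg : smooth_closure g) by now apply spikes_smooth.
assert (g_ge0 : forall t, 0 <= g t) by now apply spikes_ge0.
assert (g_eq0 : forall t, t <= 1 / 2 -> g t = 0) by apply spikes_eq0.
assert (g_le : forall t, 0 <= t -> g t <= Y t ^ 3) by (intros; now apply spikes_bounds).
assert (g_wint : forall T, 0 <= T -> RInt (fun t => Y t ^ 3 * g t) 0 T <= delta).
{ intros T HT; replace delta with (4 / (4 / delta)) by (field; lra).
  now apply RInt_weighted_spikes. }
assert (SY3 : smooth_closure (fun t => Y t ^ 3)) by now apply smooth_closure_pow.
(* The weight $Y^3$ is at least 1, so the unweighted integral inherits the bound. *)
assert (g_int : forall T, 0 <= T -> RInt g 0 T <= delta).
{ intros T HT; eapply Rle_trans; [|apply (g_wint T HT)].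
  apply RInt_le; [easy| | |].
  - apply ex_RInt_of_continuous; intros; now apply smooth_closure_continuous.
  - apply ex_RInt_of_continuous; intros; now apply smooth_closure_continuous, sc_mult.
  - intros x Hx; specialize (Yge x ltac:(lra)); specialize (g_ge0 x).
    assert (1 <= Y x ^ 3) by (apply pow_R1_Rle; lra); nra. }
assert (Hsmall : delta / beta ^ 2 <= 1 / 2) by (unfold X1, Rdiv in *; lra).
destruct (deformed_total_curvature f f1 f2 g beta delta) with A cM as [c' [Hc' Hcc]]; try easy.
destruct (deformed_L2 f f1 f2 g beta delta) with (fun t => Y t ^ 3) delta
  as [l [Hl Hlb]]; try easy.
{ intros; now apply smooth_closure_continuous. }
exists (deformed f g), (deformed2 f f1 f2 g), c'.
split; [now apply deformed_model_surface with f1 beta delta|].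
split; [now apply deformed_second_deriv|].
split; [easy|].
split; [now apply deformed_radial_curv_ge with beta delta|].
split; [|split].
- exists l; split; [easy|].
  rewrite <- (sqrt_pow2 eps) by lra; apply sqrt_lt_1_alt; split; [easy|].
  apply Rle_lt_trans with (4 / beta ^ 4 * delta); [easy|].
  replace (4 / beta ^ 4 * delta) with (eps ^ 2 * (delta * X2))
    by (unfold X2; field; lra).
  rewrite <- (Rmult_1_r (eps ^ 2)) at 2; apply Rmult_lt_compat_l; lra.
- apply deformed_radial_curv_unbounded with beta delta Y (exp (- 2)) c C T1; try easy.
  + apply exp_pos.
  + intros n Hn; now apply spikes_INR.
- eapply Rle_lt_trans; [apply Hcc|].
  replace (4 * PI * _) with (eps * (delta * X3)) by (unfold X3; field; lra).
  rewrite <- (Rmult_1_r eps) at 2; apply Rmult_lt_compat_l; lra.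
Qed.
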